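(* For every integer $n \geq 570571$, $$\sigma^{*}(n) \leq 1.3007\, n \log\log n.$$
   Context: A positive integer $d$ is a unitary divisor of the positive integer $n$ if $d \mid n$ and $\gcd(d, n/d) = 1$. The function $\sigma^{*}(n) = \sum_{d \mid n,\ \gcd(d, n/d) = 1} d$ is the sum of all unitary divisors of $n$. Here $\log$ is the natural logarithm, and $1.3007$ denotes this exact decimal number. *)

(* Defs.v *)
From mathcomp Require Import all_boot.
Set Implicit Arguments.
Unset Strict Implicit.
Unset Printing Implicit Defensive.

Definition unitary_divisor (d n : nat) : bool := (d %| n) && coprime d (n %/ d).

Definition usigma (n : nat) : nat := \sum_(1 <= d < n.+1 | unitary_divisor d n) d.

(* Main.v *)
(* [sigma*(n) / n <= prod_{p | n} (1 + 1/p)], and for a given number k of prime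
   divisors this product is largest, and [n] smallest, at the first k primes.  So
   for k >= 8 it suffices that [prod_{p < M} (1 + 1/p) <= 1.3007 ln theta(M)] for
   [M >= 20]; this is verified by computation below [2 ^ 14].  Beyond that,
   comparing the prime factorization of [N!] with [theta(N) <= N ln 4] bounds
   [sum_{p <= N} ln p / p], Abel summation from [2 ^ 14] on turns this into a bound
   on the product, and the central binomial coefficient gives [theta(N) >= 3 N / 5].
   For k <= 7 the product is below [1.3007 ln ln n] once [n >= 1021020], and the
   remaining [n] with seven prime divisors are settled according to whether all
   of 2, 3, 5, 7, 11, 13 divide [n]. *)
From Stdlib Require Import BinNat Nnat.
Require Import Defs.
From mathcomp Require Import all_boot all_order all_algebra.
From mathcomp Require Import reals exp.
From mathcomp Require Import topology normedtype sequences.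
From mathcomp Require Import zify ring lra.
Import Order.TTheory GRing.Theory Num.Theory.
Local Open Scope ring_scope.

(** * Unitary divisors, and [usigma n / n] against the product over the prime divisors of [n] *)

Definition unitary_divisors (n : nat) : seq nat := [seq d <- divisors n | coprime d (n %/ d)].

Lemma mem_unitary_divisors n d : (0 < n)%N ->
  (d \in unitary_divisors n) = unitary_divisor d n.
Proof. by move=> n0; rewrite mem_filter -dvdn_divisors // andbC. Qed.

Lemma unitary_divisors_uniq n : uniq (unitary_divisors n).
Proof. by rewrite filter_uniq // divisors_uniq. Qed.

Lemma usigmaE n : (0 < n)%N -> usigma n = (\sum_(d <- unitary_divisors n) d)%N.
Proof.
move=> n0; rewrite /usigma -big_filter; apply: perm_big.
apply: uniq_perm; rewrite ?unitary_divisors_uniq ?filter_uniq ?iota_uniq //.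
move=> d; rewrite mem_unitary_divisors // mem_filter mem_index_iota ltnS.
rewrite andbC; case: (boolP (unitary_divisor d n)) => [/andP[dn _]|]; last by rewrite andbF.
by rewrite (dvdn_gt0 n0 dn) (dvdn_leq n0 dn).
Qed.

(** A unitary divisor of [p ^ a * m] contains either no factor [p] or all of [p ^ a], so it is a
    unitary divisor of [m] or [p ^ a] times one. *)
Lemma usigma_pfactorM p a m : prime p -> (0 < a)%N -> (0 < m)%N -> coprime p m ->
  (usigma (p ^ a * m) <= (1 + p ^ a) * usigma m)%N.
Proof.
move=> p_pr a0 m0 cpm; have pa0 : (0 < p ^ a)%N by rewrite expn_gt0 prime_gt0.
have pam0 : (0 < p ^ a * m)%N by rewrite muln_gt0 pa0.
rewrite !usigmaE // mulnDl mul1n big_distrr /=.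
rewrite -(big_map (fun d => p ^ a * d)%N xpredT (fun d => d)) -big_cat /=.
apply: (@uniq_sub_le_big _ _ leq leqnn (fun x y => leq_addr y x)) => //.
- exact: unitary_divisors_uniq.
- rewrite cat_uniq unitary_divisors_uniq map_inj_uniq ?unitary_divisors_uniq //=.
    rewrite andbT; apply/hasPn => _ /mapP[d _ ->]; rewrite mem_unitary_divisors //.
    apply/negP => /andP[dm _]; move: cpm; rewrite prime_coprime // => /negP[].
    by apply: dvdn_trans dm; rewrite dvdn_mulr // -(prednK a0) expnS dvdn_mulr.
  by move=> x y /eqP; rewrite eqn_pmul2l // => /eqP.
move=> d; rewrite mem_unitary_divisors // => /andP[/dvdnP[e E] c].
have d0 : (0 < d)%N by move: pam0; rewrite E muln_gt0 => /andP[].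
rewrite E mulnK // in c; rewrite mem_cat; apply/orP.
(* [d] is coprime to its cofactor [e]; if [p] divides [d] it does not divide [e], so the whole of
   [p ^ a] divides [d]. *)
have [pd|pd] := boolP (p %| d)%N.
  have : (p ^ a %| d)%N.
    rewrite -(@Gauss_dvdr _ e); first by rewrite -E dvdn_mulr.
    by rewrite coprimeXl // (coprime_dvdl pd).
  case/dvdnP => f dE; right; apply/mapP; exists f; last by rewrite mulnC.
  rewrite mem_unitary_divisors //.
  have -> : m = (e * f)%N.
    by apply/eqP; rewrite -(eqn_pmul2l pa0) E dE; apply/eqP; ring.
  have f0 : (0 < f)%N by move: d0; rewrite dE muln_gt0 => /andP[].
  rewrite /unitary_divisor dvdn_mull //= mulnK //.
  by apply: coprime_dvdl c; rewrite dE dvdn_mulr.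
left; rewrite mem_unitary_divisors //.
have cdp : coprime d (p ^ a) by rewrite coprime_sym coprimeXl // prime_coprime.
have : (p ^ a %| e)%N.
  by rewrite -(@Gauss_dvdl _ _ d) 1?coprime_sym // -E dvdn_mulr.
case/dvdnP => f eE.
have -> : m = (f * d)%N.
  by apply/eqP; rewrite -(eqn_pmul2l pa0) E eE; apply/eqP; ring.
rewrite /unitary_divisor dvdn_mull //= mulnK //.
by apply: coprime_dvdr c; rewrite eE dvdn_mulr.
Qed.

(** Strong induction, splitting off one full prime power; [1 + p ^ a <= p ^ a * (1 + 1 / p)] because
    [p <= p ^ a]. *)
Lemma usigma_le (R : realType) n : (0 < n)%N ->
  (usigma n)%:R <= n%:R * \prod_(p <- primes n) (1 + p%:R^-1) :> R.
Proof.
elim/ltn_ind: n => n IHn n0; have [n1|n1] := leqP n 1.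
  have -> : n = 1%N by lia.
  by rewrite usigmaE //= /unitary_divisors /= big_cons !big_nil mulr1.
have [p p_pr p_n] : exists2 p, prime p & (p %| n)%N.
  by exists (pdiv n); rewrite ?pdiv_prime ?pdiv_dvd.
have [m cpm nE] := pfactor_coprime p_pr n0.
have a0 : (0 < logn p n)%N by rewrite logn_gt0 mem_primes p_pr n0 p_n.
move: (logn p n) a0 nE => a a0 nE.
have m0 : (0 < m)%N by lia.
have mn : (m < n)%N.
  rewrite nE -{1}[m]muln1 ltn_pmul2l // -(expn0 p) ltn_exp2l ?prime_gt1 //.
have perm : perm_eq (primes n) (p :: primes m).
  apply: uniq_perm; rewrite /= ?primes_uniq ?andbT //.
    rewrite mem_primes p_pr m0 /=; move: cpm; rewrite prime_coprime //.
  move=> q; rewrite nE primesM ?m0 ?expn_gt0 ?prime_gt0 //.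
  by rewrite primesX // (primes_prime p_pr) !inE orbC.
rewrite (perm_big _ perm) big_cons /=.
have pa0 : (0 < p ^ a)%N by rewrite expn_gt0 prime_gt0.
have h1 : (usigma n)%:R <= (1 + (p ^ a)%:R) * (usigma m)%:R :> R.
  have -> : (1 + (p ^ a)%:R) * (usigma m)%:R = ((1 + p ^ a) * usigma m)%:R :> R.
    by rewrite natrM natrD.
  by rewrite ler_nat nE mulnC usigma_pfactorM.
apply: (le_trans h1).
have nR : n%:R = (p ^ a)%:R * m%:R :> R by rewrite -natrM nE mulnC.
have paR : 0 < (p ^ a)%:R :> R by rewrite ltr0n.
have pR : 0 < p%:R :> R by rewrite ltr0n prime_gt0.
have h2 : 1 + (p ^ a)%:R <= (p ^ a)%:R * (1 + p%:R^-1) :> R.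
  rewrite mulrDr mulr1 addrC lerD2l ler_pdivlMr // mul1r ler_nat.
  by rewrite -{1}(expn1 p) leq_exp2l ?prime_gt1.
rewrite nR -mulrA (mulrCA m%:R) (mulrA (p ^ a)%:R).
apply: ler_pM => //; last exact: IHn.
by rewrite addr_ge0 ?ler0n.
Qed.

(** * Primes below a bound, and the extremality of the first primes *)

Definition primes_below (M : nat) : seq nat := [seq p <- iota 0 M | prime p].

Lemma mem_primes_below M p : (p \in primes_below M) = (p < M)%N && prime p.
Proof. by rewrite mem_filter mem_iota add0n andbC. Qed.

Lemma primes_belowS M :
  primes_below M.+1 = if prime M then rcons (primes_below M) M else primes_below M.
Proof.
rewrite /primes_below -addn1 iotaD filter_cat /= add0n.
by case: (prime M); rewrite ?cats1 ?cats0.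
Qed.

(** Raising [M] by one adds at most one prime, and there are infinitely many primes, so no count is
    skipped. *)
Lemma size_primes_below_surj k : exists M, size (primes_below M) = k.
Proof.
have surj M : (k <= size (primes_below M))%N -> exists M, size (primes_below M) = k.
  elim: M => [|M IHM]; first by rewrite /= leqn0 => /eqP ->; exists 0%N.
  rewrite leq_eqVlt => /orP[/eqP->|]; first by exists M.+1.
  rewrite primes_belowS; case: (prime M); rewrite ?size_rcons => h; apply: IHM; lia.
suff [M kM] : exists M, (k <= size (primes_below M))%N by apply: surj kM.
elim: k {surj} => [|k [M kM]]; first by exists 0%N.
have [p Mp p_pr] := prime_above M; exists p.+1.
rewrite primes_belowS p_pr size_rcons ltnS; apply: leq_trans kM _.
rewrite /primes_below -(subnKC (ltnW Mp)) iotaD filter_cat size_cat.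
exact: leq_addr.
Qed.

(* Exchange argument: each prime of [s] outside [primes_below M] is at least [M],
   and each of them replaces a prime below [M]. *)
Lemma prod_primes_below_ge (R : realType) (f : nat -> R) (s : seq nat) M :
  (forall m n, (0 < m)%N -> (m <= n)%N -> 0 <= f n <= f m) ->
  uniq s -> all prime s -> size s = size (primes_below M) ->
  \prod_(p <- s) f p <= \prod_(p <- primes_below M) f p.
Proof.
move=> f_anti s_uniq s_pr sz; set t := primes_below M.
have perm_s : perm_eq s ([seq p <- s | p \in t] ++ [seq p <- s | p \notin t]).
  by rewrite perm_sym perm_filterC.
have perm_t : perm_eq t ([seq p <- t | p \in s] ++ [seq p <- t | p \notin s]).
  by rewrite perm_sym perm_filterC.
have common : perm_eq [seq p <- s | p \in t] [seq p <- t | p \in s].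
  apply: uniq_perm; rewrite ?filter_uniq ?iota_uniq // => p.
  by rewrite !mem_filter andbC.
rewrite (perm_big _ perm_s) (perm_big _ perm_t) !big_cat /= (perm_big _ common) /=.
have pr_gt0 p : prime p -> (0 < p)%N by apply: prime_gt0.
have t_pr p : p \in t -> prime p by rewrite mem_primes_below => /andP[].
apply: ler_wpM2l.
  rewrite big_seq; apply: prodr_ge0 => p; rewrite mem_filter => /andP[_ /t_pr p_pr].
  by case/andP: (f_anti p p (pr_gt0 _ p_pr) (leqnn p)).
(* From here on [f M] is the pivot: exchanged primes of [s] contribute at most [f M] each, those of
   [t] at least [f M]. The case [M = 0] goes first since [f] is controlled at positive arguments
   only. *)
have [M0|M_gt0] := posnP M.
  have : size s = 0%N by rewrite sz M0.
  by move/size0nil => s0; rewrite /t s0 M0 /= !big_nil.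
have sz' : size [seq p <- s | p \notin t] = size [seq p <- t | p \notin s].
  apply/eqP; rewrite -(eqn_add2l (size [seq p <- s | p \in t])) -size_cat.
  by rewrite (perm_size common) -size_cat -(perm_size perm_s) -(perm_size perm_t) sz.
have f_ge0 p : (0 < p)%N -> 0 <= f p by move=> p0; case/andP: (f_anti p p p0 (leqnn p)).
have le_s (u : seq nat) : all (leq M) u -> \prod_(p <- u) f p <= f M ^+ size u.
  elim: u => [|p u IHu] /=; first by rewrite big_nil expr0.
  move=> /andP[Mp Mu]; rewrite big_cons exprS; apply: ler_pM.
  - by apply: f_ge0; lia.
  - rewrite big_seq prodr_ge0 // => q /(allP Mu) Mq.
    by apply: f_ge0; apply: leq_trans Mq.
  - by case/andP: (f_anti M p M_gt0 Mp).
  - exact: IHu.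
have le_t (u : seq nat) : all (fun p => 0 < p < M)%N u -> f M ^+ size u <= \prod_(p <- u) f p.
  elim: u => [|p u IHu] /=; first by rewrite big_nil expr0.
  move=> /andP[/andP[p0 pM] Mu]; rewrite big_cons exprS; apply: ler_pM.
  - exact: f_ge0.
  - by rewrite exprn_ge0 ?f_ge0.
  - by case/andP: (f_anti p M p0 (ltnW pM)).
  - exact: IHu.
apply: le_trans (le_s _ _) _; last rewrite sz'; last apply: le_t.
  apply/allP => p; rewrite mem_filter mem_primes_below => /andP[pM ps].
  by move: pM; rewrite (allP s_pr _ ps) andbT -leqNgt.
apply/allP => p; rewrite mem_filter mem_primes_below => /andP[_ /andP[pM p_pr]].
by rewrite pM prime_gt0.
Qed.

(** * Primorials and central binomial coefficients *)

Lemma primes_below_cat m n : (m <= n)%N ->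
  primes_below n = primes_below m ++ [seq p <- iota m (n - m) | prime p].
Proof. by move=> mn; rewrite /primes_below -{1}(subnKC mn) iotaD filter_cat. Qed.

Lemma prime_dvd_fact p n : prime p -> (p %| n`!)%N = (p <= n)%N.
Proof.
move=> p_pr; apply/idP/idP => [|pn]; last by rewrite dvdn_fact // prime_gt0.
elim: n => [|n IHn]; first by rewrite fact0 dvdn1 => /eqP p1; rewrite p1 in p_pr.
by rewrite factS Euclid_dvdM // => /orP[/dvdn_leq->//|/IHn/leqW].
Qed.

Lemma prod_primes_dvd (s : seq nat) n :
  uniq s -> all prime s -> all (fun p => p %| n)%N s -> (\prod_(p <- s) p %| n)%N.
Proof.
elim: s => [|p s IHs] /=; first by rewrite big_nil dvd1n.
move=> /andP[ps us] /andP[p_pr s_pr] /andP[pn sn].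
rewrite big_cons Gauss_dvd ?pn ?IHs // prime_coprime //.
rewrite big_seq; apply: (big_ind (fun x => ~~ (p %| x)%N)) => [|x y px py|q qs].
  by rewrite Euclid_dvd1.
  by rewrite Euclid_dvdM // negb_or px.
rewrite dvdn_prime2 ?p_pr ?(allP s_pr q qs) //.
by apply: contraNneq ps => ->.
Qed.

Lemma central_binS n : ('C(n.+1.*2, n.+1) = 2 * 'C(n.*2.+1, n))%N.
Proof.
have := mul_bin_diag n.+1.*2 n; rewrite doubleS /= => h.
apply/eqP; rewrite -(eqn_pmul2l (ltn0Sn n)) -h; apply/eqP; lia.
Qed.

Lemma odd_binE n : (n.+1 * 'C(n.*2.+1, n) = n.*2.+1 * 'C(n.*2, n))%N.
Proof. by have := mul_bin_down n.*2.+1 n; rewrite /= => ->; congr (_ * _)%N; lia. Qed.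

(** By the two recurrences, going from [n] to [n + 1] multiplies the coefficient by
    [(4 n + 6) / (n + 2)], which is below 4. *)
Lemma odd_bin_le n : ('C(n.*2.+1, n) <= 4 ^ n)%N.
Proof.
elim: n => [|n IHn] //; have := odd_binE n.+1; rewrite central_binS expnS => h.
rewrite -(leq_pmul2l (ltn0Sn n.+1)) h mulnA.
have -> : (n.+2 * (4 * 4 ^ n) = n.+2 * 4 * 4 ^ n)%N by rewrite mulnA.
by apply: leq_mul => //; lia.
Qed.

Lemma central_bin_ge n : (4 ^ n <= n.*2.+1 * 'C(n.*2, n))%N.
Proof.
elim: n => [|n IHn] //; rewrite expnS central_binS.
have := odd_binE n; lia.
Qed.

(** Erdős's argument: for [n = 2 m + 1] the primes in [(m + 1, 2 m + 1]] all divide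
    ['C(2 m + 1, m) <= 4 ^ m], and induction covers those up to [m + 1]. An even [n > 2] is not
    prime. *)
Lemma primorial_le n : (\prod_(p <- primes_below n.+1) p <= 4 ^ n)%N.
Proof.
elim/ltn_ind: n => n IHn.
have [n2|n2] := leqP n 2.
  by case: n n2 {IHn} => [|[|[|]]] //= _; rewrite /primes_below /= ?big_cons big_nil.
have [on|en] := boolP (odd n); last first.
  rewrite primes_belowS; case: ifP => [/even_prime[n2'|]|_]; try lia.
  by case: n en n2 IHn => // n _ _ IHn; apply: leq_trans (IHn n _) _; rewrite ?leq_exp2l.
have [m nE] : exists m, n = m.*2.+1 by exists n./2; lia.
have m0 : (0 < m)%N by lia.
rewrite nE (@primes_below_cat m.+2) ?big_cat /=; last lia.
have -> : (4 ^ m.*2.+1 = 4 ^ m.+1 * 4 ^ m)%N by rewrite -expnD; congr expn; lia.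
apply: leq_mul; first by apply: IHn; lia.
apply: leq_trans (odd_bin_le m).
have C0 : (0 < 'C(m.*2.+1, m))%N by rewrite bin_gt0; lia.
apply: dvdn_leq => //; apply: prod_primes_dvd.
- by rewrite filter_uniq ?iota_uniq.
- exact: filter_all.
apply/allP => p; rewrite mem_filter mem_iota => /andP[p_pr /andP[mp pm]].
have h : ('C(m.*2.+1, m) * (m`! * (m.*2.+1 - m)`!) = m.*2.+1`!)%N by rewrite bin_fact; lia.
have : (p %| m.*2.+1`!)%N by rewrite prime_dvd_fact //; lia.
rewrite -h !Euclid_dvdM // !prime_dvd_fact // => /orP[//|/orP[]]; lia.
Qed.

(** * Chebyshev's function, Mertens sums and products, and logarithms of integers *)

Section RealPrimeSums.
Variable R : realType.
Implicit Types (M N n p : nat).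

Definition theta M : R := \sum_(p <- primes_below M) ln p%:R.
Definition mertens_sum M : R := \sum_(p <- primes_below M) ln p%:R / p%:R.
Definition mertens_prod M : R := \prod_(p <- primes_below M) (1 + p%:R^-1).

Lemma ln_nat_ge0 n : 0 <= ln n%:R :> R.
Proof.
case: n => [|n]; last by rewrite ln_ge0 // (ler_nat _ 1).
(* [ln 0] is 0 by convention. *)
by rewrite le_eqVlt eq_sym; apply/orP; left; apply/eqP/ln0.
Qed.

Lemma ln_nat_gt0 n : (1 < n)%N -> 0 < ln n%:R :> R.
Proof. by move=> n1; rewrite ln_gt0 // (ltr_nat _ 1). Qed.

Lemma ler_ln_nat m n : (0 < m)%N -> (m <= n)%N -> ln m%:R <= ln n%:R :> R.
Proof. by move=> m0 mn; rewrite ler_ln ?posrE ?ltr0n ?ler_nat //; lia. Qed.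

Lemma ln_natM m n : (0 < m)%N -> (0 < n)%N -> ln (m * n)%:R = ln m%:R + ln n%:R :> R.
Proof. by move=> m0 n0; rewrite natrM lnM ?posrE ?ltr0n. Qed.

Lemma ln_natX m n : (0 < m)%N -> ln (m ^ n)%:R = n%:R * ln m%:R :> R.
Proof. by move=> m0; rewrite natrX lnXn ?ltr0n // mulr_natl. Qed.

Lemma ln_prod (s : seq nat) (f : nat -> nat) : (forall p, p \in s -> (0 < f p)%N) ->
  ln (\prod_(p <- s) f p)%N%:R = \sum_(p <- s) ln (f p)%:R :> R.
Proof.
elim: s => [|p s IHs] h; first by rewrite !big_nil ln1.
rewrite !big_cons ln_natM ?h ?mem_head //.
  by rewrite IHs // => q qs; rewrite h // in_cons qs orbT.
rewrite big_seq; apply: prodn_cond_gt0 => q qs; apply: h.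
by rewrite in_cons qs orbT.
Qed.

Lemma primes_below_gt0 M p : p \in primes_below M -> (0 < p)%N.
Proof. by rewrite mem_primes_below => /andP[_ /prime_gt0]. Qed.

Lemma thetaE M : theta M = ln (\prod_(p <- primes_below M) p)%N%:R.
Proof. by rewrite ln_prod // => p; apply: primes_below_gt0. Qed.

Lemma theta_le N : theta N.+1 <= N%:R * (2 * ln 2).
Proof.
rewrite thetaE; have -> : N%:R * (2 * ln 2) = ln (4 ^ N)%N%:R :> R.
  by rewrite ln_natX // (_ : 4 = 2 ^ 2)%N // ln_natX.
apply: ler_ln_nat; last exact: primorial_le.
rewrite big_seq; apply: prodn_cond_gt0 => p; exact: primes_below_gt0.
Qed.

(** Primes not dividing [n] have valuation 0; summing over all primes below [M] allows term-by-term
    comparison with [theta] and [mertens_sum]. *)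
Lemma ln_primes_below n M : (0 < n)%N -> (forall p, p \in primes n -> (p < M)%N) ->
  ln n%:R = \sum_(p <- primes_below M) (logn p n)%:R * ln p%:R :> R.
Proof.
move=> n0 nM; rewrite (bigID (fun p => p \in primes n)) /=.
rewrite [X in _ + X]big1 ?addr0; last first.
  by move=> p; rewrite -logn_gt0 lt0n negbK => /eqP ->; rewrite mul0r.
rewrite -big_filter (@perm_big _ _ _ _ _ (primes n)); last first.
  apply: uniq_perm; rewrite ?filter_uniq ?iota_uniq ?primes_uniq // => p.
  rewrite mem_filter mem_primes_below; case: (boolP (p \in primes n)) => // pn.
  by rewrite nM //=; move: pn; rewrite mem_primes => /andP[].
rewrite {1}[n]prod_prime_decomp // prime_decompE big_map /= ln_prod; last first.
  by move=> p; rewrite mem_primes => /andP[p_pr _]; rewrite expn_gt0 prime_gt0.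
apply: eq_big_seq => p; rewrite mem_primes => /andP[p_pr _].
by rewrite ln_natX ?prime_gt0.
Qed.

(** * Upper bounds for Mertens sums and products from the factorization of [N!] *)

Lemma ln_fact_le N : (0 < N)%N ->
  ln N`!%:R <= N%:R * ln N%:R - N%:R + ln N%:R + 1 :> R.
Proof.
elim: N => // -[|N] IHN _; first by rewrite ln1; lra.
rewrite factS ln_natM ?fact_gt0 //.
have := IHN isT; rewrite -(natr1 N.+1).
have : 0 < N.+1%:R :> R by rewrite ltr0n.
move: N.+1%:R => x x0 {IHN} IHN.
(* The induction step amounts to [1 <= (x + 1) * ln ((x + 1) / x)]. *)
have h : ln (x / (x + 1)) <= - (x + 1)^-1.
  have -> : x / (x + 1) = 1 + - (x + 1)^-1 by field; apply: lt0r_neq0; lra.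
  by apply: le_ln1Dx; rewrite ltrN2 invf_lt1; lra.
move: h; rewrite ln_div ?posrE; try lra.
rewrite -(@ler_pM2l _ (x + 1)); last lra.
rewrite mulrN divff; last (apply: lt0r_neq0; lra).
nra.
Qed.

Lemma divn_ge_real m d : (0 < d)%N -> m%:R / d%:R - 1 <= (m %/ d)%N%:R :> R.
Proof.
move=> d0; rewrite lerBlDr natr1 ler_pdivrMr ?ltr0n // -natrM ler_nat.
by rewrite ltnW // ltn_ceil.
Qed.

Lemma logn_fact_ge p N : prime p -> N%:R / p%:R - 1 <= (logn p N`!)%:R :> R.
Proof.
move=> p_pr; case: N => [|N].
  by rewrite mul0r; apply: (@le_trans _ _ 0); rewrite ?ler0n //; lra.
apply: le_trans (divn_ge_real _ _ (prime_gt0 p_pr)) _.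
by rewrite ler_nat logn_fact // big_ltn // expn1 leq_addr.
Qed.

(** Terms 2 to 4 of Legendre's formula for the exponent of [p] in [N!], per unit of [N]. Keeping
    them for the [small_primes] sharpens the constant of the Mertens bound. *)
Definition higher_powers p : R := p%:R ^- 2 + p%:R ^- 3 + p%:R ^- 4.

(** The first four terms of Legendre's formula, each floor losing at most 1; [4 <= N] makes all four
    occur in the sum. *)
Lemma logn_fact_ge4 p N : prime p -> (4 <= N)%N ->
  N%:R / p%:R - 1 + (N%:R * higher_powers p - 3) <= (logn p N`!)%:R :> R.
Proof.
move=> p_pr N4; have p0 := prime_gt0 p_pr.
have -> : logn p N`! = (N %/ p ^ 1 + (N %/ p ^ 2 + (N %/ p ^ 3 + (N %/ p ^ 4 +
    \sum_(5 <= k < N.+1) N %/ p ^ k))))%N.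
  by rewrite logn_fact // 4?big_ltn //; lia.
rewrite !natrD.
have h k : N%:R * p%:R ^- k - 1 <= (N %/ p ^ k)%N%:R :> R.
  by rewrite -natrX divn_ge_real // expn_gt0 p0.
have := h 1%N; have := h 2%N; have := h 3%N; have := h 4%N.
have : 0 <= (\sum_(5 <= k < N.+1) N %/ p ^ k)%N%:R :> R by rewrite ler0n.
by rewrite /higher_powers expr1; lra.
Qed.

Definition small_primes : seq nat := [:: 2; 3; 5; 7]%N.

(** Legendre's formula gives [ln N!] at least [N * mertens_sum - theta] plus the higher powers of
    the small primes. Comparing with [ln_fact_le] and [theta_le] and dividing by [N] gives the
    bound. *)
Lemma mertens_sum_le N : (7 <= N)%N ->
  mertens_sum N.+1 <= ln N%:R + 2 * ln 2 - 1
    - \sum_(p <- small_primes) higher_powers p * ln p%:R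
    + (ln N%:R + 1 + 3 * \sum_(p <- small_primes) ln p%:R) / N%:R.
Proof.
move=> N7; have N0 : 0 < N%:R :> R by rewrite ltr0n; lia.
have lnN : ln N`!%:R = \sum_(p <- primes_below N.+1) (logn p N`!)%:R * ln p%:R :> R.
  apply: ln_primes_below; first exact: fact_gt0.
  by move=> p; rewrite mem_primes fact_gt0 /= => /andP[p_pr]; rewrite prime_dvd_fact.
have lb : \sum_(p <- primes_below N.+1) (N%:R / p%:R - 1) * ln p%:R
    + \sum_(p <- small_primes) (N%:R * higher_powers p - 3) * ln p%:R <= ln N`!%:R.
  have s8 : small_primes = primes_below 8 by [].
  rewrite lnN s8 !(@primes_below_cat 8 N.+1) // !big_cat /= addrAC -big_split /=.
  apply: lerD; rewrite big_seq [X in _ <= X]big_seq; apply: ler_sum => p.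
    rewrite mem_primes_below => /andP[_ p_pr]; rewrite -mulrDl.
    by rewrite ler_wpM2r ?ln_nat_ge0 // logn_fact_ge4 //; lia.
  rewrite mem_filter => /andP[p_pr _].
  by rewrite ler_wpM2r ?ln_nat_ge0 // logn_fact_ge.
have e1 : \sum_(p <- primes_below N.+1) (N%:R / p%:R - 1) * ln p%:R
    = N%:R * mertens_sum N.+1 - theta N.+1.
  rewrite /mertens_sum /theta big_distrr -sumrB /=; apply: eq_bigr => p _; ring.
have e2 : \sum_(p <- small_primes) (N%:R * higher_powers p - 3) * ln p%:R
    = N%:R * (\sum_(p <- small_primes) higher_powers p * ln p%:R)
      - 3 * \sum_(p <- small_primes) ln p%:R.
  rewrite !big_distrr -sumrB /=; apply: eq_bigr => p _; ring.
rewrite {}e1 {}e2 in lb.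
have := ln_fact_le N (ltn_trans (isT : 0 < 6)%N N7); have := theta_le N.
move: lb; set C := (\sum_(p <- _) higher_powers _ * _); set D := (\sum_(p <- _) ln _).
move=> h1 h2 h3.
rewrite -(@ler_pM2l _ N%:R) // mulrDr mulrCA divff ?mulr1; last exact: lt0r_neq0.
lra.
Qed.

(* Abel summation against the decreasing weight [1 / ln k]; the sum of
   [(ln k - ln (k - 1)) / ln k] telescopes because [1 - 1 / t <= ln t]. *)
Lemma sum_div_ln_le (a : nat -> R) (d : R) X N : (1 < X)%N -> (X <= N)%N ->
  (forall n, (X <= n)%N -> \sum_(X <= k < n.+1) a k <= ln n%:R - ln X%:R + d) ->
  \sum_(X <= k < N.+1) a k / ln k%:R <= ln (ln N%:R) - ln (ln X%:R) + d / ln X%:R.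
Proof.
(* [D n] is the nonpositive excess of the partial sum over its bound. The induction keeps the
   boundary term [D N / ln N] of Abel summation, which is dropped only at the end. *)
move=> X1 XN aX; pose D n : R := \sum_(X <= k < n.+1) a k - (ln n%:R - ln X%:R + d).
have D_le0 n : (X <= n)%N -> D n <= 0 by move=> /aX; rewrite subr_le0.
suff h : \sum_(X <= k < N.+1) a k / ln k%:R
    <= ln (ln N%:R) - ln (ln X%:R) + d / ln X%:R + D N / ln N%:R.
  apply: le_trans h _; rewrite gerDl pmulr_lle0 ?D_le0 //.
  by rewrite invr_gt0 ln_nat_gt0 //; lia.
elim: N XN => [|N IHN]; first by lia.
rewrite leq_eqVlt => /orP[/eqP XN|XN].
  by rewrite /D -XN !big_nat1; lra.
rewrite big_nat_recr /=; last exact: leqW.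
have := IHN XN; have DS : D N.+1 = D N + a N.+1 - (ln N.+1%:R - ln N%:R).
  by rewrite /D (big_nat_recr N.+1) /=; [lra|exact: leqW].
rewrite DS; have := D_le0 N XN; have lN := @ln_nat_gt0 N (leq_trans X1 XN).
have lNS : ln N%:R <= ln N.+1%:R :> R by apply: ler_ln_nat; lia.
move: (D N) (a N.+1) (\sum_(_ <= _ < _) _) lN lNS => E b s.
move: (ln N%:R) (ln N.+1%:R) => u v u0 uv E0 h {DS IHN}.
have v0 : 0 < v by apply: lt_le_trans uv.
have : ln (u / v) <= u / v - 1.
  rewrite -{1}(subrK 1 (u / v)) (addrC _ 1) le_ln1Dx //.
  by have := divr_gt0 u0 v0; lra.
rewrite ln_div ?posrE // => lnuv.
(* Since [E <= 0] and [u <= v], moving the boundary term from weight [1 / u] to [1 / v] can only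
   increase it. *)
have key : E / u - E / v <= 0.
  have -> : E / u - E / v = E * ((v - u) / (u * v)) by field; rewrite !lt0r_neq0.
  by apply: mulr_le0_ge0 => //; apply: divr_ge0; [lra|rewrite mulr_ge0 ?ltW].
have -> : (E + b - (v - u)) / v = E / v + b / v - 1 + u / v by field; rewrite lt0r_neq0.
lra.
Qed.

(** Each factor satisfies [1 + 1 / p <= expR (1 / p)], and [1 / p] is [ln p / p] with weight
    [1 / ln p], so [sum_div_ln_le] bounds the exponent. *)
Lemma mertens_prod_le (d : R) X N : (1 < X)%N -> (X <= N)%N ->
  (forall n, (X <= n)%N ->
     mertens_sum n.+1 - mertens_sum X <= ln n%:R - ln X%:R + d) ->
  mertens_prod N.+1 <= mertens_prod X * (ln N%:R / ln X%:R * expR (d / ln X%:R)).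
Proof.
move=> X1 XN hX; have XN' := leqW XN.
rewrite /mertens_prod (primes_below_cat _ _ XN') big_cat /=.
apply: ler_wpM2l; first by apply: prodr_ge0 => p _; rewrite addr_ge0 ?invr_ge0.
pose a k : R := if prime k then ln k%:R / k%:R else 0.
have aX n : (X <= n)%N -> \sum_(X <= k < n.+1) a k <= ln n%:R - ln X%:R + d.
  move=> Xn; apply: le_trans (hX n Xn); rewrite -big_mkcond /= /mertens_sum.
  by rewrite (primes_below_cat _ _ (leqW Xn)) big_cat /= addrAC subrr add0r big_filter.
have := sum_div_ln_le a d X N X1 XN aX.
have lX : 0 < ln X%:R :> R by rewrite ln_nat_gt0.
have lN : 0 < ln N%:R :> R by rewrite ln_nat_gt0 // (leq_trans X1).
rewrite -ln_div ?posrE // => h.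
apply: le_trans (_ : expR (\sum_(X <= k < N.+1) a k / ln k%:R) <= _); last first.
  rewrite -[X in X * expR _](@lnK _ (_ / _)) ?posrE ?divr_gt0 // -expRD.
  by rewrite ler_expR.
rewrite expR_sum big_filter -/(index_iota X N.+1) [X in _ <= X](bigID prime) /=.
rewrite [X in _ * X]big1 ?mulr1; last by move=> p /negbTE pN; rewrite /a pN mul0r expR0.
apply: ler_prod => p p_pr; rewrite addr_ge0 ?invr_ge0 //=.
rewrite /a p_pr mulrAC divff ?mul1r ?expR_ge1Dx //.
by rewrite lt0r_neq0 // ln_nat_gt0 // prime_gt1.
Qed.

(** * Lower bound for [theta] from the central binomial coefficient *)

Lemma sum_leq_indicator t m : (\sum_(1 <= k < m.+1) (k <= t) <= t)%N.
Proof.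
suff : (\sum_(1 <= k < m.+1) (k <= t) <= minn m t)%N by lia.
elim: m => [|m IHm]; first by rewrite big_geq.
by rewrite big_nat_recr //=; move: IHm; case: (leqP m.+1 t); lia.
Qed.

(** In Legendre's formula the [k]-th term of [(2 n)!] exceeds twice that of [n!] by at most 1, and
    by 0 once [p ^ k > 2 n]. *)
Lemma logn_central_bin p n : prime p -> (0 < n)%N ->
  (logn p 'C(n.*2, n) <= trunc_log p n.*2)%N.
Proof.
move=> p_pr n0; have p1 := prime_gt1 p_pr.
have := @bin_fact n.*2 n (leq_trans (leq_addr n n) _); rewrite addnn => /(_ (leqnn _)).
have -> : (n.*2 - n = n)%N by lia.
move/(congr1 (logn p)); rewrite !lognM ?muln_gt0 ?fact_gt0 ?bin_gt0 //; last lia.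
(* The sum for [n!] is padded with zero terms up to [2 n], to match the one for [(2 n)!]. *)
have ext : logn p n`! = (\sum_(1 <= k < n.*2.+1) n %/ p ^ k)%N.
  rewrite logn_fact // [RHS](@big_cat_nat _ _ _ n.+1) //=; last lia.
  rewrite [X in (_ + X)%N]big_nat_cond [X in (_ + X)%N]big1 ?addn0 // => k.
  move=> /andP[/andP[nk _] _]; rewrite divn_small // (leq_trans nk) // ltnW //.
  exact: ltn_expl.
rewrite {1 2}ext logn_fact // => h.
set t := trunc_log p n.*2.
have {h} : (logn p 'C(n.*2, n) + (\sum_(1 <= k < n.*2.+1) n %/ p ^ k +
    \sum_(1 <= k < n.*2.+1) n %/ p ^ k) <= \sum_(1 <= k < n.*2.+1) (k <= t) +
    (\sum_(1 <= k < n.*2.+1) n %/ p ^ k + \sum_(1 <= k < n.*2.+1) n %/ p ^ k))%N.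
  rewrite h -!big_split /=; apply: leq_sum => k _.
  have pk0 : (0 < p ^ k)%N by rewrite expn_gt0 prime_gt0.
  have [kt|tk] := leqP k t.
    have := ltn_ceil n pk0; have := leq_trunc_div n.*2 (p ^ k); nia.
  by rewrite divn_small // (leq_trans (trunc_log_ltn _ p1)) // leq_exp2l.
rewrite leq_add2r => h; exact: leq_trans h (sum_leq_indicator _ _).
Qed.

(** A prime above [s] satisfies [p ^ 2 > 2 n], so its exponent is at most 1. Each of the at most [s]
    remaining primes contributes at most [ln (2 n)]. *)
Lemma ln_central_bin_le n s : (0 < n)%N -> (n.*2 < s.+1 ^ 2)%N ->
  ln 'C(n.*2, n)%:R <= theta n.*2.+1 + s%:R * ln n.*2%:R.
Proof.
move=> n0 ns; have C0 : (0 < 'C(n.*2, n))%N by rewrite bin_gt0; lia.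
rewrite (@ln_primes_below _ n.*2.+1) //; last first.
  move=> p; rewrite mem_primes C0 /= => /andP[p_pr pC]; rewrite ltnS -prime_dvd_fact //.
  by rewrite -(@bin_fact n.*2 n) ?dvdn_mulr //; lia.
have ln2n := ln_nat_ge0 n.*2.
apply: le_trans (_ : \sum_(p <- primes_below n.*2.+1)
    (ln p%:R + if (p <= s)%N then ln n.*2%:R else 0) <= _).
  rewrite big_seq [X in _ <= X]big_seq; apply: ler_sum => p.
  rewrite mem_primes_below => /andP[_ p_pr].
  have h := logn_central_bin p n p_pr n0; have p1 := prime_gt1 p_pr.
  have pt : (p ^ trunc_log p n.*2 <= n.*2)%N by apply: trunc_logP => //; lia.
  have lnp := ln_nat_ge0 p.
  have [ps|sp] := leqP p s.
    apply: (@le_trans _ _ (ln n.*2%:R)); last by rewrite lerDr.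
    rewrite -ln_natX ?prime_gt0 //; apply: ler_ln_nat; first by rewrite expn_gt0 prime_gt0.
    by apply: leq_trans pt; rewrite leq_exp2l.
  rewrite addr0 -[X in _ <= X]mul1r ler_wpM2r // (ler_nat _ _ 1).
  apply: leq_trans h _; rewrite -ltnS -(ltn_exp2l _ _ p1).
  by apply: leq_ltn_trans pt (leq_trans ns _); rewrite leq_exp2r.
rewrite big_split /= lerD2l -big_mkcond /= -big_filter big_const_seq count_predT.
rewrite iter_addr_0 -[_ *+ size _]mulr_natl ler_wpM2r // ler_nat.
rewrite -[X in (_ <= X)%N](size_iota 1); apply: uniq_leq_size.
  by rewrite !filter_uniq ?iota_uniq.
move=> p; rewrite mem_filter mem_primes_below mem_iota => /andP[ps /andP[_ p_pr]].
by rewrite prime_gt0 //=; lia.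
Qed.

Lemma theta_ge n s : (0 < n)%N -> (n.*2 < s.+1 ^ 2)%N ->
  n.*2%:R * ln 2 - ln n.*2.+1%:R - s%:R * ln n.*2%:R <= theta n.*2.+1.
Proof.
move=> n0 ns; have := ln_central_bin_le n s n0 ns.
have := central_bin_ge n; rewrite -(ler_nat R) natrM natrX => h.
have : ln (4 ^+ n) <= ln (n.*2.+1%:R * 'C(n.*2, n)%:R) :> R.
  by rewrite ler_ln ?posrE ?exprn_gt0 ?mulr_gt0 ?ltr0n ?bin_gt0 //; lia.
rewrite lnM ?posrE ?ltr0n ?bin_gt0 //; last lia.
rewrite -natrX (_ : 4 = 2 ^ 2)%N // -expnM ln_natX // mul2n; lra.
Qed.

(** * Rational lower bounds for logarithms *)

Lemma expR1_le : expR 1 <= 193 / 71 :> R.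
Proof.
(* [S n + 2 / n!] is nonincreasing from 9 on, so its value at 9 bounds the limit. [193 / 71] is a
   continued fraction convergent of e lying above it. *)
rewrite /expR; pose S n : R := \sum_(0 <= i < n) exp_coeff 1 i.
have SE n : series (exp_coeff 1) n = S n by [].
have cE n : exp_coeff 1 n = (n`!%:R)^-1 :> R by rewrite /exp_coeff /= expr1n mul1r.
have S_le n : (9 <= n)%N -> S n + 2 * exp_coeff 1 n <= 193 / 71.
  elim: n => // n IHn; rewrite leq_eqVlt => /orP[/eqP <-|n9].
    rewrite /S !big_nat_recr //= big_geq // !cE !factS fact0; lra.
  apply: le_trans (IHn n9); rewrite /S big_nat_recr //= -/(S n) !cE.
  have -> : (n.+1`!%:R)^-1 = (n.+1%:R)^-1 * (n`!%:R)^-1 :> R.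
    by rewrite factS natrM invfM.
  have f0 : 0 < (n`!%:R)^-1 :> R by rewrite invr_gt0 ltr0n fact_gt0.
  have g2 : (n.+1%:R)^-1 <= 2^-1 :> R by rewrite lef_pV2 ?posrE ?ltr0n ?ler_nat //; lia.
  have := ler_wpM2r (ltW f0) g2; move: (n.+1%:R^-1) (n`!%:R^-1) => g f; lra.
apply: limr_le; first exact: is_cvg_series_exp_coeff.
near=> n; rewrite SE; have n9 : (9 <= n)%N by near: n; exact: nbhs_infty_ge.
apply: le_trans (S_le n n9); rewrite lerDl mulr_ge0 // cE invr_ge0 ler0n //.
Unshelve. all: by end_near. Qed.

(** As [193 / 71] bounds e from above, the hypothesis gives [expR u <= x ^+ w]; only rational powers
    need comparing. *)
Lemma ln_ge_frac (x : R) u w : 0 < x -> (0 < w)%N ->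
  (193 / 71) ^+ u <= x ^+ w -> u%:R / w%:R <= ln x.
Proof.
move=> x0 w0 h; rewrite ler_pdivrMr ?ltr0n // mulr_natr -lnXn //.
rewrite -ler_expR lnK ?posrE ?exprn_gt0 //; apply: le_trans h.
by rewrite -[u%:R]mulr1 expRM_natl lerXn2r ?nnegrE ?expR_ge0 ?expR1_le //; lra.
Qed.

(** * A sieve in binary integers: trial division, fixed-point state, certificates *)

Lemma to_natX (x y : N) : N.to_nat (x ^ y)%num = (N.to_nat x ^ N.to_nat y)%N.
Proof.
rewrite N2Nat.inj_pow; elim: (N.to_nat y) => [|n IHn] //=.
by rewrite expnS -IHn multE.
Qed.

Lemma dvdn_to_nat (q m : N) : (N.to_nat q %| N.to_nat m)%N = N.eqb (m mod q)%num 0.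
Proof.
have E : N.to_nat (m mod q)%num = (N.to_nat m %% N.to_nat q)%N.
  rewrite N2Nat.inj_mod; case: (N.to_nat q) => [|q']; first by rewrite modn0.
  have := PeanoNat.Nat.div_mod_eq (N.to_nat m) q'.+1.
  have := PeanoNat.Nat.mod_upper_bound (N.to_nat m) q'.+1 (PeanoNat.Nat.neq_succ_0 _).
  move: (PeanoNat.Nat.modulo _ _) (PeanoNat.Nat.div _ _) => r d /ssrnat.ltP rq ->.
  by rewrite multE plusE mulnC modnMDl modn_small.
by rewrite /dvdn -E; lia.
Qed.

(** The primes below 128, enough to decide primality below [128 ^ 2 = 16384]. *)
Definition trial_divisors : seq N :=
  [:: 2; 3; 5; 7; 11; 13; 17; 19; 23; 29; 31; 37; 41; 43; 47; 53; 59; 61; 67; 71;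
      73; 79; 83; 89; 97; 101; 103; 107; 109; 113; 127]%num.

Fixpoint trial_division (l : seq N) (m : N) : bool :=
  if l is q :: l' then
    if N.eqb m q then true
    else if N.eqb (m mod q) 0 then false else trial_division l' m
  else true.

Lemma trial_division_true l m : trial_division l m ->
  (exists2 q, List.In q l & m = q) \/ (forall q, List.In q l -> ~~ (N.to_nat q %| N.to_nat m)%N).
Proof.
elim: l => [|q l IHl] /=; first by right.
case: N.eqb_spec => [->|mq]; first by left; exists q; [left|].
case: ifP => // qm /IHl[[q' q'l ->]|h]; first by left; exists q'; [right|].
right=> q' [<-|]; last exact: h.
  by rewrite dvdn_to_nat qm.
Qed.

Lemma trial_division_false l m : trial_division l m = false ->
  exists2 q, List.In q l & q <> m /\ (N.to_nat q %| N.to_nat m)%N.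
Proof.
elim: l => [|q l IHl] //=.
case: N.eqb_spec => // mq; case: ifP => [qm _|_ /IHl[q' q'l h]].
  by exists q; [left|split; [move=> qm'; apply: mq|rewrite dvdn_to_nat]].
by exists q' => //; right.
Qed.

Lemma trial_divisorsE q : (q < 128)%N -> prime q -> List.In (N.of_nat q) trial_divisors.
Proof.
move=> q128 q_pr; have :
    all (fun q => prime q ==> (q \in map N.to_nat trial_divisors)) (iota 0 128).
  by vm_compute.
move/allP => /(_ q); rewrite mem_iota q_pr => /(_ q128) /=.
by rewrite !inE; do ![case/orP => [/eqP -> /=|]; first by tauto]; move=> /eqP -> /=; tauto.
Qed.

Lemma trial_divisionE m : (1 < m)%num -> (m < 16384)%num ->
  trial_division trial_divisors m = prime (N.to_nat m).
Proof.
move=> m1 mX; have m1' : (1 < N.to_nat m)%N by lia.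
have l_pr q : List.In q trial_divisors -> prime (N.to_nat q).
  have : all (fun q => prime (N.to_nat q)) trial_divisors by vm_compute.
  by elim: trial_divisors => //= q' l IHl /andP[q'_pr l_pr] [<-|] //; apply: IHl.
case E: (trial_division _ _).
  case: (trial_division_true _ _ E) => [[q ql ->]|h]; first by rewrite l_pr.
  apply/esym/ltn_pdiv2_prime; first exact: ltnW.
  have [p128|p128] := ltnP (pdiv (N.to_nat m)) 128.
    have := h _ (trial_divisorsE _ p128 (pdiv_prime m1')).
    by rewrite Nnat.Nat2N.id pdiv_dvd.
  by apply: (@leq_trans (128 ^ 2)); [lia|rewrite leq_exp2r].
case: (trial_division_false _ _ E) => q /l_pr q_pr [qm].
case: (boolP (prime (N.to_nat m))) => // m_pr; rewrite dvdn_prime2 // => /eqP.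
by move/N2Nat.inj => /qm.
Qed.

(* Rounded down; the exponent 8 is precise enough above 128 and much cheaper. *)
Definition log2x32 (p : N) : N :=
  if N.ltb p 128 then N.log2 (p ^ 32) else (4 * N.log2 (p ^ 8))%num.

Definition scale : N := (2 ^ 40)%num.

(* [(q, t, e)]: [q / scale] bounds the Mertens product from above; [t] and
   [e / scale] bound, in units of [ln 2 / 32], the sums of [ln p] and of
   [ln p / p] from below. *)
Definition sieve_state := (N * N * N)%type.

(** The [+ 1] compensates the floor division, keeping [q] an upper bound; the other two components
    are rounded down. *)
Definition sieve_step (m : N) (s : sieve_state) : sieve_state :=
  if trial_division trial_divisors m then
    let: (q, t, e) := s in let l := log2x32 m in
    (q + q / m + 1, t + l, e + l * scale / m)%num
  else s.

Fixpoint sieve_run (k : nat) (m : N) (s : sieve_state) : sieve_state :=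
  if k is k'.+1 then sieve_run k' (N.succ m) (sieve_step m s) else s.

(** The comparison [(193 / 71) ^ u <= (a / b) ^ w] with denominators cleared; it certifies
    [u / w <= ln (a / b)]. *)
Definition ln_ge_check (u w a b : N) : bool :=
  N.leb (193 ^ u * b ^ w) (71 ^ u * a ^ w).

(** Thresholds for the state reached at [2 ^ 14]; [final_state_bounds] trades them for the short
    fractions [305 / 29] and [1575 / 131]. *)
Definition q_final : N := 11563570533152.

Definition e_final : N := 423019946975000.

(* A segment [(k, u, w)] starting at [m] certifies
   [mertens_prod (m + k) <= 1.3007 u / w <= 1.3007 ln (theta m)],
   with [70 / 101] standing for [ln 2]. *)
Fixpoint check_segments (segs : seq (N * N * N)) (m : N) (s : sieve_state) : bool :=
  if segs is (k, u, w) :: segs' then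
    let s' := sieve_run (N.to_nat k) m s in
    let m' := (m + k)%num in
    [&& N.ltb 0 w, N.ltb 0 s.1.2, N.ltb m' 16384,
        N.leb (10000 * s'.1.1 * w) (13007 * u * scale),
        ln_ge_check u w (70 * s.1.2) 3232
      & check_segments segs' (N.succ m') (sieve_step m' s')]
  else [&& N.eqb m 16384, N.leb s.1.1 q_final & N.leb e_final s.2].

(** An entry of length [k] covers the [k + 1] values from [m] to [m + k], so the eleven entries run
    from 20 to [2 ^ 14 - 1]. *)
Definition segments : seq (N * N * N) :=
  [:: (3, 36, 13); (5, 26, 9); (7, 28, 9); (9, 10, 3); (25, 11, 3); (65, 46, 11);
      (173, 29, 6); (567, 176, 31); (2327, 101, 15); (12251, 201, 25); (921, 9, 1)]%num.

Lemma segments_checked :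
  check_segments segments 20 (sieve_run 18 2 (scale, 0, 0)%num).
Proof. by vm_compute. Qed.

Lemma final_state_bounds : N.leb (29 * q_final) (305 * scale) /\
  N.leb (32 * 1575 * scale) (131 * e_final).
Proof. by split; vm_compute. Qed.

(** * Soundness of the sieve and its certificate *)

Definition rN (x : N) : R := (N.to_nat x)%:R.

Lemma rN_add x y : rN (x + y)%num = rN x + rN y.
Proof. by rewrite /rN N2Nat.inj_add plusE natrD. Qed.

Lemma rN_mul x y : rN (x * y)%num = rN x * rN y.
Proof. by rewrite /rN N2Nat.inj_mul multE natrM. Qed.

Lemma rN_exp x y : rN (x ^ y)%num = rN x ^+ N.to_nat y.
Proof. by rewrite /rN to_natX natrX. Qed.

Lemma rN_le x y : N.leb x y -> rN x <= rN y.
Proof. by move=> xy; rewrite ler_nat; lia. Qed.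

Lemma rN_gt0 x : N.ltb 0 x -> 0 < rN x.
Proof. by move=> x0; rewrite ltr0n; lia. Qed.

Lemma rN_ge0 x : 0 <= rN x. Proof. exact: ler0n. Qed.

Lemma rN_div_bounds x y : N.ltb 0 y -> rN (x / y) <= rN x / rN y <= rN (x / y) + 1.
Proof.
move=> y0; have yR := rN_gt0 _ y0.
have E : x = (y * (x / y) + x mod y)%num by apply: N.div_mod; lia.
have r_lt : N.lt (x mod y) y by apply: N.mod_lt; lia.
have rE : rN x = rN y * rN (x / y) + rN (x mod y) by rewrite -rN_mul -rN_add -E.
have r_le : rN (x mod y) <= rN y by apply: rN_le; lia.
have r_ge := rN_ge0 (x mod y).
by rewrite ler_pdivlMr // ler_pdivrMr // rE; apply/andP; split; lra.
Qed.

Lemma rN_log2_le x : N.ltb 0 x -> rN (N.log2 x) * ln 2 <= ln (rN x).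
Proof.
move=> x0; have [h _] : (2 ^ N.log2 x <= x)%num /\ (x < 2 ^ N.succ (N.log2 x))%num.
  by apply: N.log2_spec; lia.
have E : rN 2 = 2 by [].
rewrite /rN mulr_natl -lnXn // -E -rN_exp.
by rewrite ler_ln ?posrE ?rN_gt0 ?rN_le //; [lia|apply/N.ltb_spec0; lia].
Qed.

Lemma log2x32_le (p : N) : N.ltb 0 p -> rN (log2x32 p) * ln 2 <= 32 * ln (rN p).
Proof.
move=> p0; have pow_gt0 k : N.ltb 0 (p ^ k)%num.
  have : (p ^ k)%num <> 0%num by apply: N.pow_nonzero; lia.
  by case: (p ^ k)%num.
have h k : rN (N.log2 (p ^ k)) * ln 2 <= (N.to_nat k)%:R * ln (rN p).
  by apply: le_trans (rN_log2_le _ (pow_gt0 k)) _; rewrite rN_exp lnXn ?rN_gt0 // mulr_natl.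
rewrite /log2x32; case: ifP => _; first exact: (h 32%num).
rewrite rN_mul -mulrA; have := h 8%num.
rewrite (_ : rN 4 = 4) // (_ : (N.to_nat 8)%:R = 8 :> R) //; lra.
Qed.

Lemma theta_recr M : theta M.+1 = theta M + (if prime M then ln M%:R else 0).
Proof.
rewrite /theta primes_belowS; case: ifP => _; last by rewrite addr0.
by rewrite -cats1 big_cat /= big_seq1.
Qed.

Lemma mertens_sum_recr M :
  mertens_sum M.+1 = mertens_sum M + (if prime M then ln M%:R / M%:R else 0).
Proof.
rewrite /mertens_sum primes_belowS; case: ifP => _; last by rewrite addr0.
by rewrite -cats1 big_cat /= big_seq1.
Qed.

Lemma mertens_prod_recr M :
  mertens_prod M.+1 = mertens_prod M * (if prime M then 1 + M%:R^-1 else 1).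
Proof.
rewrite /mertens_prod primes_belowS; case: ifP => _; last by rewrite mulr1.
by rewrite -cats1 big_cat /= big_seq1.
Qed.

Definition sieve_invariant (M : nat) (s : sieve_state) : Prop :=
  [/\ mertens_prod M * rN scale <= rN s.1.1,
      rN s.1.2 * ln 2 <= 32 * theta M
    & rN s.2 * ln 2 <= 32 * rN scale * mertens_sum M].

Lemma sieve_stepP (m : N) s : (1 < m)%num -> (m < 16384)%num ->
  sieve_invariant (N.to_nat m) s -> sieve_invariant (N.to_nat m).+1 (sieve_step m s).
Proof.
move=> m1 mX [hq ht he]; rewrite /sieve_invariant theta_recr mertens_sum_recr mertens_prod_recr.
rewrite -trial_divisionE // /sieve_step; case: ifP => _; last by rewrite mulr1 !addr0.
case: s hq ht he => [[q t] e] /= hq ht he.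
have m0 : N.ltb 0 m by lia.
have mR := rN_gt0 _ m0; have hl := log2x32_le _ m0; have hm := rN_div_bounds.
move: scale hq he => c hq he; have c_ge0 := rN_ge0 c.
have rN1 : rN 1 = 1 by [].
split.
- rewrite 2!rN_add rN1 -/(rN m).
  have [_ h] := andP (rN_div_bounds q m m0).
  rewrite mulrAC mulrDr mulr1.
  have : mertens_prod (N.to_nat m) * rN c / rN m <= rN q / rN m.
    by apply: ler_wpM2r hq; rewrite invr_ge0 ltW.
  lra.
- by rewrite rN_add mulrDl mulrDr lerD.
have [h _] := andP (rN_div_bounds (log2x32 m * c) m m0).
rewrite rN_add mulrDl [X in _ <= X]mulrDr lerD //.
have ln2 := ln_nat_ge0 2.
apply: le_trans (ler_wpM2r ln2 h) _; rewrite rN_mul -/(rN m).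
have cm : 0 <= rN c / rN m by rewrite divr_ge0 // ltW.
have := ler_wpM2r cm hl; lra.
Qed.

Lemma ln_ge_checkP (u w a b : N) : N.ltb 0 w -> N.ltb 0 a -> N.ltb 0 b ->
  ln_ge_check u w a b -> rN u / rN w <= ln (rN a / rN b).
Proof.
move=> w0 a0 b0 /rN_le; rewrite !rN_mul !rN_exp => h.
have aR := rN_gt0 _ a0; have bR := rN_gt0 _ b0.
apply: ln_ge_frac; [exact: divr_gt0|lia|].
rewrite !expr_div_n ler_pdivrMr ?exprn_gt0 ?ltr0n // mulrAC.
rewrite ler_pdivlMr ?exprn_gt0 // [X in _ <= X]mulrC.
exact: h.
Qed.

Lemma ln2_ge : 70 / 101 <= ln 2 :> R.
Proof.
by have := @ln_ge_checkP 70 101 2 1 isT isT isT isT; rewrite (_ : rN 1 = 1) // divr1.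
Qed.

Lemma theta_homo M M' : (M <= M')%N -> theta M <= theta M'.
Proof.
move=> MM'; rewrite -(subnKC MM'); elim: (M' - M)%N => [|k IHk]; first by rewrite addn0.
rewrite addnS theta_recr; apply: le_trans IHk _; rewrite lerDl.
by case: ifP => // _; apply: ln_nat_ge0.
Qed.

Lemma mertens_prod_homo M M' : (M <= M')%N -> mertens_prod M <= mertens_prod M'.
Proof.
move=> MM'; rewrite -(subnKC MM'); elim: (M' - M)%N => [|k IHk]; first by rewrite addn0.
rewrite addnS mertens_prod_recr; apply: le_trans IHk _.
apply: ler_peMr; first by apply: prodr_ge0 => p _; rewrite addr_ge0 ?invr_ge0.
by case: ifP => // _; rewrite lerDl invr_ge0.
Qed.

Lemma sieve_runP k (m : N) s : (1 < m)%num -> (m + N.of_nat k <= 16384)%num ->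
  sieve_invariant (N.to_nat m) s -> sieve_invariant (N.to_nat m + k) (sieve_run k m s).
Proof.
elim: k m s => [|k IHk] m s m1 mk inv_s /=; first by rewrite addn0.
have -> : (N.to_nat m + k.+1 = N.to_nat (N.succ m) + k)%N by lia.
apply: IHk; try lia.
have -> : N.to_nat (N.succ m) = (N.to_nat m).+1 by lia.
by apply: sieve_stepP => //; lia.
Qed.

(** [3232 = 32 * 101]: the unit [ln 2 / 32] of [t] is at least [70 / 3232]. *)
Lemma rN_ln2_le (t : N) (x : R) : rN t * ln 2 <= 32 * x -> rN (70 * t) / rN 3232 <= x.
Proof.
move=> h; rewrite rN_mul.
have -> : rN 70 = 70 by [].
have -> : rN 3232 = 101 * 32 by rewrite -[3232%num]/(101 * 32)%num rN_mul.
rewrite ler_pdivrMr; last lra.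
have := ler_wpM2l (rN_ge0 t) ln2_ge; lra.
Qed.

Lemma scaled_le (q u w c : N) (x : R) : 0 < rN w -> 0 < rN c ->
  x * rN c <= rN q -> rN (10000 * q * w) <= rN (13007 * u * c) ->
  x <= 13007 / 10000 * (rN u / rN w).
Proof.
move=> wR cR q_ge; rewrite !rN_mul.
have -> : rN 10000 = 10000 by [].
have -> : rN 13007 = 13007 by [].
move=> q_le; rewrite mulrA ler_pdivlMr // -(ler_pM2r cR).
have := ler_wpM2r (ltW wR) q_ge; lra.
Qed.

(** Both sides are monotone in [M], so on a segment it suffices to compare the product at the right
    end with [theta] at the left end. *)
Lemma check_segmentsP segs (m : N) s : (1 < m)%num -> (m <= 16384)%num ->
  sieve_invariant (N.to_nat m) s -> check_segments segs m s ->
  (forall M, (N.to_nat m <= M < N.to_nat 16384)%N ->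
     mertens_prod M <= 13007 / 10000 * ln (theta M)) /\
  exists2 s', sieve_invariant (N.to_nat 16384) s' &
    N.leb s'.1.1 q_final && N.leb e_final s'.2.
Proof.
(* Naming the bound keeps it from being expanded into a unary numeral. *)
have [X XE] : exists X, X = N.to_nat 16384 by exists (N.to_nat 16384).
rewrite -XE; elim: segs m s => [|[[k u] w] segs IHs] m s m1 mX inv_s /=.
  case/and3P=> /N.eqb_eq mE q_le e_ge; have {}mE : N.to_nat m = X by rewrite mE.
  split; first by move=> M; rewrite mE; lia.
  by exists s; [rewrite -mE|apply/andP].
set m' := (m + k)%num; set s' := sieve_run _ _ _.
case/and5P=> w0 t0 m'X q_le /andP[u_le segs_ok].
have m'E : N.to_nat m' = (N.to_nat m + N.to_nat k)%N by rewrite /m' N2Nat.inj_add.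
have m'1 : (1 < m')%num by move: m1 {IHs inv_s q_le u_le segs_ok}; lia.
have {}m'X : (m' < 16384)%num by apply/N.ltb_spec0.
have inv_s' : sieve_invariant (N.to_nat m') s'.
  by rewrite m'E; apply: sieve_runP => //; rewrite N2Nat.id; apply: N.lt_le_incl.
have inv_s'' : sieve_invariant (N.to_nat (N.succ m')) (sieve_step m' s').
  by rewrite N2Nat.inj_succ; apply: sieve_stepP inv_s'.
have [|| IH1 IH2] := IHs (N.succ m') (sieve_step m' s') _ _ inv_s'' segs_ok.
- exact: N.lt_lt_succ_r.
- exact/N.le_succ_l.
split => // M /andP[mM MX]; have [m'M|Mm'] := ltnP (N.to_nat m') M.
  by apply: IH1; rewrite N2Nat.inj_succ m'M.
have [_ t_le _] := inv_s; have [q_ge _ _] := inv_s'.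
have t0' : N.ltb 0 (70 * s.1.2) by case: (s.1.2) t0.
have := ln_ge_checkP _ _ _ _ w0 t0' (isT : N.ltb 0 3232) u_le.
have th_ge := rN_ln2_le _ _ t_le.
have T0 : 0 < rN (70 * s.1.2) / rN 3232 by rewrite divr_gt0 ?rN_gt0.
move=> h {t_le t0 t0' u_le segs_ok inv_s IHs}.
have th_gt0 : 0 < theta M by apply: lt_le_trans T0 (le_trans th_ge (theta_homo _ _ mM)).
have ln_th : rN u / rN w <= ln (theta M).
  apply: le_trans h _; rewrite ler_ln ?posrE //.
  exact: le_trans th_ge (theta_homo _ _ mM).
apply: le_trans (ler_wpM2l _ ln_th); last by rewrite divr_ge0.
apply: le_trans (mertens_prod_homo _ _ Mm') _.
have wR := rN_gt0 _ w0; have cR : 0 < rN scale by apply: rN_gt0.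
move: (rN_le _ _ q_le) => {}q_le; exact: scaled_le wR cR q_ge q_le.
Qed.

Lemma sieve_invariant2 : sieve_invariant 2 (scale, 0, 0)%num.
Proof.
rewrite /sieve_invariant /mertens_prod /theta /mertens_sum.
have -> : primes_below 2 = [::] by [].
have rN0 : rN 0 = 0 by [].
split; rewrite big_nil ?mulr0 ?mul1r; first exact: lexx.
  by rewrite [X in rN X]/= rN0 mul0r.
by rewrite [X in rN X * _]/= rN0 mul0r.
Qed.

Lemma sieve_certificate :
  (forall M, (20 <= M < N.to_nat 16384)%N ->
     mertens_prod M <= 13007 / 10000 * ln (theta M)) /\
  exists2 s', sieve_invariant (N.to_nat 16384) s' &
    N.leb s'.1.1 q_final && N.leb e_final s'.2.
Proof.
apply: (check_segmentsP segments 20 _ _ _ _ segments_checked); [by []|by []|].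
by apply: (sieve_runP 18 2); [by []|by []|exact: sieve_invariant2].
Qed.

(** * Explicit estimates beyond [2 ^ 14] *)

Lemma ln2_le : ln 2 <= 7 / 10 :> R.
Proof.
rewrite -ler_expR lnK ?posrE //.
(* [expR (7 / 640)] is at least [1 + 7 / 640], whose 64th power already exceeds 2. *)
have -> : 7 / 10 = 64%:R * (7 / 640) :> R by lra.
rewrite expRM_natl; apply: (@le_trans _ _ ((1 + 7 / 640) ^+ 64)); last first.
  by rewrite lerXn2r ?nnegrE ?expR_ge0 ?expR_ge1Dx //; lra.
have -> : 1 + 7 / 640 = rN 647 / rN 640.
  by rewrite (_ : rN 647 = 647) // (_ : rN 640 = 640) //; lra.
rewrite expr_div_n ler_pdivlMr ?exprn_gt0 ?rN_gt0 //.
have := rN_le (2 * 640 ^ 64) (647 ^ 64) isT.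
by rewrite rN_mul !rN_exp (_ : rN 2 = 2).
Qed.

Lemma ln_ge_ln2 (a b n : N) : N.ltb 0 b -> N.ltb 0 n -> N.leb (2 ^ a) (n ^ b) ->
  rN a / rN b * ln 2 <= ln (rN n).
Proof.
move=> b0 n0 /rN_le h; have bR := rN_gt0 _ b0; have nR := rN_gt0 _ n0.
rewrite mulrAC ler_pdivrMr // [X in _ <= X]mulrC /rN !mulr_natl -!lnXn //.
move: h; rewrite !rN_exp (_ : rN 2 = 2) // => h.
by rewrite ler_ln ?posrE ?exprn_gt0.
Qed.

Lemma ln_le_tangent (x c : R) : 0 < x -> 0 < c -> ln x <= ln c + (x / c - 1).
Proof.
move=> x0 c0; have xc := divr_gt0 x0 c0.
have -> : ln x = ln c + ln (x / c) by rewrite ln_div ?posrE //; lra.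
rewrite lerD2l -{1}(subrK 1 (x / c)) (addrC _ 1) le_ln1Dx //; lra.
Qed.

Lemma sqrt_nat_ex m : exists s, (s ^ 2 <= m < s.+1 ^ 2)%N.
Proof.
elim: m => [|m [s /andP[sm ms]]]; first by exists 0%N.
have [h|h] := ltnP m.+1 (s.+1 ^ 2); first by exists s; rewrite h leqW.
by exists s.+1; rewrite h /= (leq_ltn_trans ms) // ltn_exp2r.
Qed.

(* The point where the numerical verification hands over to the asymptotic bounds. *)
Definition X0 : nat := N.to_nat 16384.

Lemma X0E : X0 = (2 ^ 14)%N.
Proof. by rewrite /X0 -[16384%num]/(2 ^ 14)%num to_natX. Qed.

(** [theta_ge] with [s] the integer square root of [2 n]. The main term is about [M * ln 2]; tangent
    lines at 128 and [128 ^ 2] make the logarithmic losses linear in [M]. *)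
Lemma theta_ge_linear M : (X0 <= M)%N -> 3 / 5 * M%:R <= theta M.+1.
Proof.
rewrite X0E => XM; pose n := M./2.
have [n_le n_ge] : (n.*2 <= M)%N /\ (M <= n.*2.+1)%N by rewrite /n; split; lia.
have M1 : (128 * 128 <= M)%N by apply: leq_trans XM.
have n0 : (0 < n)%N by lia.
have [s /andP[sn ns]] := sqrt_nat_ex n.*2.
have s127 : (128 <= s.+1)%N.
  by rewrite -(@leq_exp2r 128 s.+1 2) // (leq_trans M1) // (leq_trans n_ge).
have h := theta_ge n s n0 ns.
apply: le_trans (theta_homo n.*2.+1 M.+1 n_le); apply: le_trans h.
have M0 : (0 < M)%N by lia.
have ln2n : ln n.*2%:R <= ln M%:R :> R by apply: ler_ln_nat; lia.
have ln2n1 : ln n.*2.+1%:R <= ln (2 * M)%:R :> R by apply: ler_ln_nat; lia.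
rewrite ln_natM // in ln2n1.
have Ms : ln M%:R <= 2 * ln s.+1%:R :> R.
  by rewrite -ln_natX //; apply: ler_ln_nat => //; apply: leq_trans n_ge ns.
have y0 : 0 < s.+1%:R :> R by rewrite ltr0n.
have y128 : 128 <= s.+1%:R :> R by rewrite (ler_nat R 128).
have lny := ln_le_tangent s.+1%:R 128 y0 ltac:(lra).
have lnm := ln_le_tangent M%:R (128 * 128) ltac:(by rewrite ltr0n) ltac:(lra).
have ln128 : ln 128 = 7 * ln 2 :> R by rewrite -(ln_natX 2 7).
have ln128' : ln (128 * 128) = 14 * ln 2 :> R by rewrite lnM ?posrE // ln128; lra.
(* [s ^ 2 <= M] and [127 <= s] give [s * (s + 1) <= (1 + 1 / 127) * M]. *)
have ssM : s%:R * s.+1%:R * 127 <= 128 * M%:R :> R.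
  by rewrite -!natrM ler_nat; nia.
have nM : M%:R - 1 <= n.*2%:R :> R by rewrite lerBlDr natr1 ler_nat.
have MR : 128 * 128 <= M%:R :> R by rewrite -(natrM R 128 128) ler_nat.
have s0 : 0 <= s%:R :> R := ler0n _ _.
have l1 := ln2_ge; have l2 := ln2_le.
rewrite {}ln128 in lny; rewrite {}ln128' in lnm.
move: s.+1%:R M%:R n.*2%:R s%:R (ln s.+1%:R) (ln M%:R) (ln n.*2%:R) (ln n.*2.+1%:R) (ln 2)
  lny lnm Ms ln2n ln2n1 l1 l2 y0 y128 ssM nM MR s0.
move=> y m n2 r ly lM l2n l2n1 l {n n_le n_ge M XM M1 M0 n0 s sn ns s127}.
move=> lny lnm Ms ln2n ln2n1 l1 l2 y0 y128 ssM nM MR r0.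
(* As [1 <= 7 * l] and [128 <= y], the tangent bound [7 * l + (y / 128 - 1)] can be made
   proportional to [y], so that [ssM] applies to [r * y]. *)
have h1 : ly <= 7 * l * (y / 128).
  have := mulr_ge0 (_ : 0 <= 7 * l - 1) (_ : 0 <= y / 128 - 1); nra.
have h2 : r * l2n <= 14 * l * (m / 127).
  have h3 : r * l2n <= r * (14 * l * (y / 128)) by apply: ler_wpM2l => //; lra.
  have : (r * y * 127) * l <= 128 * m * l by apply: ler_wpM2r => //; lra.
  lra.
(* [113 / 127 = 1 - 14 / 127] by [h2], and 16 collects the stray multiples 1, 1 and 14 of [ln 2]. *)
have h4 : 70 / 101 * (113 / 127 * m - 16) <= l * (113 / 127 * m - 16).
  by apply: ler_wpM2r => //; lra.
have h5 : (m - 1) * l <= n2 * l by apply: ler_wpM2r => //; lra.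
lra.
Qed.

Lemma sum_higher_powers_ge :
  872 / 1000 * ln 2 <= \sum_(p <- small_primes) higher_powers p * ln p%:R :> R.
Proof.
rewrite /small_primes !big_cons big_nil /higher_powers.
have l3 : 19 / 12 * ln 2 <= ln 3 :> R by apply: (ln_ge_ln2 19 12 3).
have l5 : 23 / 10 * ln 2 <= ln 5 :> R by apply: (ln_ge_ln2 23 10 5).
have l7 : 14 / 5 * ln 2 <= ln 7 :> R by apply: (ln_ge_ln2 14 5 7).
have := ln2_ge; lra.
Qed.

Lemma sum_ln_small_primes_le : \sum_(p <- small_primes) ln p%:R <= 9 * ln 2 :> R.
Proof.
rewrite /small_primes !big_cons big_nil.
have l3 : ln 3 <= 2 * ln 2 :> R by rewrite -(ln_natX 2 2) //; apply: ler_ln_nat.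
have l5 : ln 5 <= 3 * ln 2 :> R by rewrite -(ln_natX 2 3) //; apply: ler_ln_nat.
have l7 : ln 7 <= 3 * ln 2 :> R by rewrite -(ln_natX 2 3) //; apply: ler_ln_nat.
lra.
Qed.

Lemma ln_X0 : ln X0%:R = 14 * ln 2 :> R.
Proof. by rewrite X0E ln_natX. Qed.

Lemma X0_real : X0%:R = 128 * 128 :> R.
Proof. by rewrite X0E -[14%N]/(7 + 7)%N expnD natrM. Qed.

Lemma mertens_X0 : mertens_prod X0 <= 305 / 29 /\ 1575 / 131 * ln 2 <= mertens_sum X0.
Proof.
have [h1 h2] := final_state_bounds.
have [_ [s [hq _ he] /andP[q_le e_ge]]] := sieve_certificate.
have c0 : 0 < rN scale by apply: rN_gt0.
rewrite -/X0 in hq he; move: scale q_final e_final c0 hq he q_le e_ge h1 h2 => c qf ef.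
move: X0 s => X s c0 hq he /rN_le q_le /rN_le e_ge /rN_le h1 /rN_le h2.
move: h1 h2; rewrite !rN_mul.
have -> : rN 29 = 29 by []. have -> : rN 305 = 305 by []. have -> : rN 32 = 32 by [].
have -> : rN 131 = 131 by []. have -> : rN 1575 = 1575 by [].
have l2 : 0 <= ln 2 :> R by apply: ln_nat_ge0.
move: (rN c) (rN qf) (rN ef) (rN s.1.1) (rN s.2) c0 hq he q_le e_ge.
move=> {c qf ef s} c qf ef q e c0 hq he q_le e_ge h1 h2; split.
  rewrite -(ler_pM2r c0); lra.
have h3 := ler_wpM2r l2 h2; have h4 := ler_wpM2r l2 e_ge.
rewrite -(ler_pM2l c0); lra.
Qed.

(** The computed value at [X0] is subtracted from [mertens_sum_le]. The excess is stated as a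
    multiple of [ln X0] so that [d / ln X0] in [mertens_prod_le] becomes [3 / 25]. *)
Lemma mertens_sum_increment_le N : (X0 <= N)%N ->
  mertens_sum N.+1 - mertens_sum X0 <= ln N%:R - ln X0%:R + 3 / 25 * ln X0%:R.
Proof.
move=> XN; have NR : 128 * 128 <= N%:R :> R by rewrite -X0_real ler_nat.
have N7 : (7 <= N)%N by apply: leq_trans XN; rewrite X0E.
have h := mertens_sum_le N N7; have [_ hX] := mertens_X0.
have C := sum_higher_powers_ge; have D := sum_ln_small_primes_le.
have N0 : 0 < N%:R :> R by rewrite ltr0n; lia.
have X0R : 0 < X0%:R :> R by rewrite X0_real mulr_gt0.
have t := ln_le_tangent N%:R X0%:R N0 X0R; rewrite ln_X0 X0_real in t.
rewrite ln_X0; have l2 := ln2_le; have l1 := ln2_ge.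
(* By the tangent at [X0], [ln N + 1] is at most [14 * ln 2 + N / X0]; the small primes add
   [27 * ln 2], whence 41. *)
have small : (ln N%:R + 1 + 3 * \sum_(p <- small_primes) ln p%:R) / N%:R
    <= (41 * (7 / 10) + 1) / (128 * 128) :> R.
  rewrite ler_pdivrMr //; lra.
lra.
Qed.

(** From [1 - x <= expR (- x)] at [x = 3 / 50], inverted and squared. *)
Lemma expR_frac_le : expR (3 / 25) <= (50 / 47) ^+ 2 :> R.
Proof.
have -> : 3 / 25 = 2%:R * (- - (3 / 50)) :> R by lra.
rewrite expRM_natl lerXn2r ?nnegrE ?expR_ge0 //; first lra.
rewrite expRN -[50 / 47]invf_div lef_pV2 ?posrE ?expR_gt0 //; last lra.
by have := expR_ge1Dx (- (3 / 50) : R); lra.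
Qed.

Lemma ln_three_fifths_ge : - (3 / 4 * ln 2) <= ln (3 / 5) :> R.
Proof.
have h : ln (3 / 5) = - ln (5 / 3) :> R by rewrite -lnV ?posrE ?invf_div //; lra.
have : ln ((5 / 3) ^+ 4) <= ln (2 ^+ 3) :> R by rewrite ler_ln ?posrE //; lra.
by rewrite !lnXn //; lra.
Qed.

(** Both sides are compared as linear functions of [L = ln N]: the product has slope about 1.2266,
    and its gap to 1.3007 already absorbs the loss [ln (3 / 5)] at [L = 14 * ln 2]. *)
Lemma mertens_prod_large N : (X0 <= N)%N ->
  mertens_prod N.+1 <= 13007 / 10000 * ln (theta N.+1).
Proof.
move=> XN; have X1 : (1 < X0)%N by rewrite X0E.
have h := mertens_prod_le (3 / 25 * ln X0%:R) X0 N X1 XN.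
have NR : 128 * 128 <= N%:R :> R by rewrite -X0_real ler_nat.
have lX : 0 < ln X0%:R :> R by apply: ln_nat_gt0.
have {}h := h (fun n Xn => mertens_sum_increment_le n Xn).
rewrite mulfK in h; last exact: lt0r_neq0.
apply: le_trans h _.
have [hQ _] := mertens_X0; have he := expR_frac_le.
have lnN : ln X0%:R <= ln N%:R :> R by apply: ler_ln_nat => //; rewrite X0E.
have th : ln (3 / 5 * N%:R) <= ln (theta N.+1).
  have h := theta_ge_linear N XN; have h0 : 0 < 3 / 5 * N%:R :> R by lra.
  by rewrite ler_ln ?posrE //; apply: lt_le_trans h.
have l35 : - (3 / 4 * ln 2) <= ln (3 / 5) :> R.
  exact: ln_three_fifths_ge.
have N0 : 0 < N%:R :> R by rewrite ltr0n; lia.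
rewrite lnM ?posrE ?divr_gt0 // in th.
have l1 := ln2_ge; have l2 := ln2_le.
apply: le_trans (_ : 305 / 29 * (ln N%:R / ln X0%:R * (50 / 47) ^+ 2) <= _).
  apply: ler_pM => //.
  - by apply: prodr_ge0 => p _; rewrite addr_ge0 ?invr_ge0.
  - by rewrite mulr_ge0 ?expR_ge0 // divr_ge0 // ltW // (lt_le_trans lX).
  - by apply: ler_wpM2l => //; rewrite divr_ge0 // ltW // (lt_le_trans lX).
have [lX0 lN0] : 0 < 14 * ln 2 :> R /\ 14 * ln 2 <= ln N%:R :> R by rewrite -ln_X0.
rewrite ln_X0; move: (ln N%:R) (ln (3 / 5)) (ln (theta N.+1)) (ln 2) th l35 l1 l2 lX0 lN0.
move=> L a T l th l35 l1 l2 lX0 lN0 {hQ he lnN X1 XN NR lX N0}.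
apply: le_trans (_ : 13007 / 10000 * (L - 3 / 4 * l) <= _); last by lra.
have -> : 305 / 29 * (L / (14 * l) * (50 / 47) ^+ 2)
    = 305 / 29 * (50 / 47) ^+ 2 * L / (14 * l) by field; apply: lt0r_neq0; lra.
rewrite ler_pdivrMr //; nra.
Qed.

Lemma mertens_prod_le_ln_theta M : (20 <= M)%N ->
  mertens_prod M <= 13007 / 10000 * ln (theta M).
Proof.
move=> M20; have [small _] := sieve_certificate.
have [MX|XM] := ltnP M X0; first by apply: small; rewrite M20.
rewrite leq_eqVlt in XM; case/orP: XM => [/eqP XM|].
  (* [mertens_prod_large] starts at [X0 + 1]; as [X0] is not prime, neither side changes between
     [X0] and [X0 + 1]. *)
  have XN : prime X0 = false.
    rewrite X0E; apply/negbTE/negP => /even_prime[/eqP|]; last by rewrite oddX.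
    by rewrite (@eqn_exp2l 2 14 1).
  have := mertens_prod_large X0 (leqnn _).
  by rewrite mertens_prod_recr theta_recr XN mulr1 addr0 XM.
by case: M {M20} => // M; rewrite ltnS; apply: mertens_prod_large.
Qed.

(** * From the first primes back to the prime divisors of [n] *)

Lemma prod_primes_le n : (0 < n)%N -> (\prod_(p <- primes n) p <= n)%N.
Proof.
move=> n0; apply: dvdn_leq => //; apply: prod_primes_dvd; first exact: primes_uniq.
  exact: all_prime_primes.
by apply/allP => p; rewrite mem_primes => /and3P[].
Qed.

Lemma prod_1Dinv_le (s : seq nat) M : uniq s -> all prime s ->
  size s = size (primes_below M) -> \prod_(p <- s) (1 + p%:R^-1) <= mertens_prod M.
Proof.
apply: (@prod_primes_below_ge R (fun p => 1 + p%:R^-1)) => m n m0 mn.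
rewrite addr_ge0 ?invr_ge0 //= lerD2l lef_pV2 ?posrE ?ltr0n ?ler_nat //.
exact: leq_trans mn.
Qed.

(** [n] is at least the product of its primes, hence at least the primorial with as many factors.
    The exchange lemma wants a decreasing function, so it is applied to reciprocals. *)
Lemma theta_le_ln n M : (0 < n)%N -> size (primes n) = size (primes_below M) ->
  theta M <= ln n%:R.
Proof.
move=> n0 sz; have inv_gt0 (s : seq nat) : all prime s -> 0 < \prod_(p <- s) (p%:R : R).
  elim: s => [|p s IHs] /=; first by rewrite big_nil.
  by move=> /andP[/prime_gt0 p0 /IHs]; rewrite big_cons; apply: mulr_gt0; rewrite ltr0n.
have T_pr : all prime (primes_below M) by apply: filter_all.
rewrite thetaE; apply: ler_ln_nat.
  by rewrite -(ltr0n R) natr_prod inv_gt0.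
apply: leq_trans (prod_primes_le _ n0); rewrite -(ler_nat R) !natr_prod.
rewrite -lef_pV2 ?posrE ?inv_gt0 ?all_prime_primes // -!prodfV.
apply: (@prod_primes_below_ge R (fun p => p%:R^-1)) => //.
- move=> m k m0 mk; rewrite invr_ge0 ler0n lef_pV2 ?posrE ?ltr0n ?ler_nat //.
  exact: leq_trans mk.
- exact: primes_uniq.
- exact: all_prime_primes.
Qed.

Lemma size_primes_below_homo m n : (m <= n)%N ->
  (size (primes_below m) <= size (primes_below n))%N.
Proof. by move=> mn; rewrite (primes_below_cat _ _ mn) size_cat leq_addr. Qed.

Lemma primes_ratio_le_large n : (0 < n)%N -> (8 <= size (primes n))%N ->
  \prod_(p <- primes n) (1 + p%:R^-1) <= 13007 / 10000 * ln (ln n%:R) :> R.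
Proof.
move=> n0 n8; have [M ME] := size_primes_below_surj (size (primes n)).
(* Only seven primes lie below 19. *)
have M20 : (20 <= M)%N.
  rewrite leqNgt ltnS; apply/negP => /size_primes_below_homo; rewrite ME.
  by apply/negP; rewrite -ltnNge; apply: leq_trans n8.
have sz : size (primes n) = size (primes_below M) by [].
apply: le_trans (prod_1Dinv_le _ _ (primes_uniq n) (all_prime_primes n) sz) _.
apply: le_trans (mertens_prod_le_ln_theta _ M20) _.
have th := theta_le_ln n M n0 sz.
have th0 : 0 < theta M.
  apply: lt_le_trans (theta_homo 3 _ _); last by apply: leq_trans M20.
  by rewrite /theta /primes_below /= big_seq1 ln_nat_gt0.
apply: ler_wpM2l; first by rewrite divr_ge0.
by rewrite ler_ln ?posrE // (lt_le_trans th0).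
Qed.

(** * Integers with at most seven prime divisors *)

Lemma lnln_ge (u w a b n0 : N) n : N.ltb 0 w -> N.ltb 0 a -> N.ltb 0 b -> N.ltb 0 n0 ->
  ln_ge_check u w a b -> ln_ge_check a b n0 1 -> (N.to_nat n0 <= n)%N ->
  rN u / rN w <= ln (ln n%:R).
Proof.
move=> w0 a0 b0 n00 h1 h2 nn0.
(* Two certificates are chained: [a / b <= ln n0], then [u / w <= ln (a / b)]. *)
have := ln_ge_checkP a b n0 1 b0 n00 isT h2; rewrite (_ : rN 1 = 1) // divr1 => h3.
have ab : 0 < rN a / rN b by rewrite divr_gt0 ?rN_gt0.
have n0R := rN_gt0 _ n00.
have h4 : rN a / rN b <= ln n%:R.
  apply: le_trans h3 _; rewrite ler_ln ?posrE ?(lt_le_trans n0R) ?ler_nat //.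
apply: le_trans (ln_ge_checkP _ _ _ _ w0 a0 b0 h1) _.
by rewrite ler_ln ?posrE // (lt_le_trans ab).
Qed.

Lemma lnln_ge_570571 n : (N.to_nat 570571 <= n)%N -> 18 / 7 <= ln (ln n%:R) :> R.
Proof. by move=> h; apply: (lnln_ge 18 7 131 10 570571) h; vm_compute. Qed.

Lemma lnln_ge_690690 n : (N.to_nat 690690 <= n)%N -> 44 / 17 <= ln (ln n%:R) :> R.
Proof. by move=> h; apply: (lnln_ge 44 17 67 5 690690) h; vm_compute. Qed.

Lemma lnln_ge_1021020 n : (N.to_nat 1021020 <= n)%N -> 21 / 8 <= ln (ln n%:R) :> R.
Proof. by move=> h; apply: (lnln_ge 21 8 235 17 1021020) h; vm_compute. Qed.

Lemma mertens_prod17 : mertens_prod 17 = 2304 / 715.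
Proof.
rewrite /mertens_prod (_ : primes_below 17 = [:: 2; 3; 5; 7; 11; 13]%N) //.
by rewrite !big_cons big_nil; field.
Qed.

Lemma mertens_prod18 : mertens_prod 18 = mertens_prod 17 * (18 / 17).
Proof. by rewrite mertens_prod_recr /=; congr (_ * _); lra. Qed.

Lemma mertens_prod20 : mertens_prod 20 = mertens_prod 18 * (20 / 19).
Proof. by rewrite !mertens_prod_recr /= mulr1 -!mulrA; congr (_ * (_ * _)); lra. Qed.

Lemma primes_ratio_le_six n : (N.to_nat 570571 <= n)%N -> (size (primes n) <= 6)%N ->
  \prod_(p <- primes n) (1 + p%:R^-1) <= 13007 / 10000 * ln (ln n%:R) :> R.
Proof.
move=> n_ge n6; have [M ME] := size_primes_below_surj (size (primes n)).
(* There are already seven primes below 18. *)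
have M17 : (M <= 17)%N.
  rewrite leqNgt; apply/negP => /size_primes_below_homo; rewrite ME.
  by apply/negP; rewrite -ltnNge ltnS.
have := prod_1Dinv_le _ _ (primes_uniq n) (all_prime_primes n) (esym ME).
have := mertens_prod_homo _ _ M17; rewrite mertens_prod17.
have := lnln_ge_570571 _ n_ge; lra.
Qed.

Lemma primes_ratio_le_seven n : (N.to_nat 570571 <= n)%N -> size (primes n) = 7%N ->
  \prod_(p <- primes n) (1 + p%:R^-1) <= 13007 / 10000 * ln (ln n%:R) :> R.
Proof.
move=> n_ge n7; have n0 : (0 < n)%N by case: n n_ge n7.
have us := primes_uniq n; have pr := all_prime_primes n.
have le18 : \prod_(p <- primes n) (1 + p%:R^-1) <= mertens_prod 18.
  exact: (prod_1Dinv_le _ 18 us pr n7).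
have large : (N.to_nat 1021020 <= n)%N ->
    \prod_(p <- primes n) (1 + p%:R^-1) <= 13007 / 10000 * ln (ln n%:R) :> R.
  move=> /lnln_ge_1021020; move: le18; rewrite mertens_prod18 mertens_prod17; lra.
set t := [:: 2; 3; 5; 7; 11; 13]%N.
have t_below : t = primes_below 17 by [].
have [/allP t_sub|/allPn[q qt qn]] := boolP (all (fun q => q \in primes n) t); last first.
  have [q_pr q13] : prime q /\ (q <= 13)%N.
    have := qt; rewrite t_below mem_primes_below => /andP[_ q_pr]; split=> //.
    by move: qt; rewrite /t !inE; clear; lia.
  (* Adjoining the missing [q <= 13] gives eight primes, so the product over [n] is at most
     [mertens_prod 20 / (1 + 1 / 13)]. *)
  have := prod_1Dinv_le (q :: primes n) 20.
  rewrite /= qn us q_pr pr n7 => /(_ isT isT erefl).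
  rewrite big_cons mertens_prod20 mertens_prod18 mertens_prod17.
  have q_gt0 := prime_gt0 q_pr.
  have : 13^-1 <= q%:R^-1 :> R by rewrite lef_pV2 ?posrE ?ltr0n // (ler_nat R q 13).
  have : 0 <= \prod_(p <- primes n) (1 + p%:R^-1) :> R.
    by apply: prodr_ge0 => p _; rewrite addr_ge0 ?invr_ge0.
  have := lnln_ge_570571 _ n_ge; nra.
have [p pn] : exists2 p, p \in primes n & p \notin t.
  have [/allP sub|/allPn[p pn pt]] := boolP (all (fun p => p \in t) (primes n)).
    by have := uniq_leq_size us sub; rewrite n7.
  by exists p.
move=> pt; have upt : uniq (p :: t) by rewrite /= -/t pt.
have sub : {subset p :: t <= primes n}.
  by move=> x; rewrite inE => /orP[/eqP ->|] //; exact: t_sub.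
have [_ eq_pt] := uniq_min_size upt sub (eq_leq n7).
have perm : perm_eq (primes n) (p :: t) by rewrite perm_sym; apply: uniq_perm.
have p_pr : prime p by apply: (allP pr).
have p_dvd : (p * (2 * (3 * (5 * (7 * (11 * (13 * 1)))))) %| n)%N.
  have : (\prod_(q <- primes n) q %| n)%N.
    by apply: prod_primes_dvd => //; apply/allP => x; rewrite mem_primes => /and3P[].
  by rewrite (perm_big _ perm) /t !big_cons big_nil.
have p17 : (17 <= p)%N.
  rewrite leqNgt; apply/negP => p17; move: pt; rewrite t_below mem_primes_below p17 p_pr.
  by [].
have [m nE] := dvdnP p_dvd.
(* Now [n] is a multiple of [30030 * p] with [p] at least 17, where 30030 is the product of [t];
   [690690 = 30030 * 23]. *)
have [p23|p23] := leqP 23 p.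
  have n_ge' : (N.to_nat 690690 <= n)%N.
    by have := dvdn_leq n0 p_dvd; move: p23; clear; lia.
  have ll := lnln_ge_690690 _ n_ge'.
  have pV : p%:R^-1 <= 23^-1 :> R.
    by rewrite lef_pV2 ?posrE ?ltr0n ?(ler_nat R 23) //; apply: leq_trans p23.
  rewrite (perm_big _ perm) big_cons.
  have -> : \prod_(q <- t) (1 + q%:R^-1) = 2304 / 715 :> R by rewrite -mertens_prod17.
  move: (ln (ln n%:R)) (p%:R^-1) ll pV; clear => x y /=; lra.
(* [30030 * 17 = 510510] and [30030 * 19 = 570570] are both below 570571, so [n] is at least twice
   one of them, hence at least 1021020. *)
apply: large; rewrite {}nE in n_ge *.
have [p17'|p19] : p = 17%N \/ p = 19%N.
  have : p \in iota 17 6 by rewrite mem_iota p17.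
  by rewrite !inE; do 5?[case/orP => [/eqP E|]]; try move=> /eqP E; move: p_pr; rewrite E; auto.
- by move: n_ge; rewrite p17'; clear; lia.
- by move: n_ge; rewrite p19; clear; lia.
Qed.

End RealPrimeSums.

(* Evaluates the numeral digit by digit, never building it in unary. *)
Lemma nat570571E : 570571%N = N.to_nat 570571.
Proof.
cbv [Nat.of_num_uint Nat.of_uint Nat.of_uint_acc].
by rewrite !PeanoNat.Nat.tail_mul_spec; lia.
Qed.

Theorem theorem1 (R : realType) (n : nat) (hn : (570571 <= n)%N) :
  (usigma n)%:R <= 13007 / 10000 * n%:R * ln (ln n%:R) :> R.
Proof.
have n_ge : (N.to_nat 570571 <= n)%N by rewrite -nat570571E.
have n0 : (0 < n)%N by apply: leq_trans n_ge; lia.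
apply: le_trans (usigma_le R n n0) _.
rewrite [13007 / 10000 * _]mulrC -mulrA; apply: ler_wpM2l; first exact: ler0n.
have [n8|n7] := leqP 8 (size (primes n)); first exact: primes_ratio_le_large.
rewrite ltnS leq_eqVlt in n7; case/orP: n7 => [/eqP n7|n6].
  exact: primes_ratio_le_seven.
exact: primes_ratio_le_six.
Qed.
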